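(* Let $t, r, j, n$ be integers such that $n\ge t > r > j \ge 1$, and let $C>0$ and $p>0$ be real numbers satisfying \[ p > \frac{t-j}{r-j} \quad \text{ and } \quad C^p \ge \binom{n}{j} \binom{\tilde{s}_{\mathbb{R}}-j}{r-j}^p , \] where $\tilde{s}_{\mathbb{R}}$ is the unique real number maximizing the function $\tilde{h}(x) = \dfrac{\binom{x}{t}}{\binom{x}{j}\binom{x-j}{r-j}^p}$ on the interval $(t-1,\infty)$. If $\mathcal{H}$ is an $n$-vertex $r$-uniform hypergraph with $\|\mathcal{H}\|_{j,p}\le C$, then \[ k_t^{(r)}(\mathcal{H}) \le \frac{\binom{n}{j}}{\binom{u}{j}} \binom{u}{t}, \] where $u \ge \tilde{s}_{\mathbb{R}}$ is the unique real number satisfying $\binom{n}{j}^{1/p} \binom{u-j}{r-j} = C$.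
   Context: An $r$-uniform hypergraph ($r$-graph) $\mathcal{H}$ is a collection of $r$-subsets (edges) of a finite vertex set $V$. For an integer $j$ with $1\le j<r$ and a $j$-subset $S\in\binom{V}{j}$, $\deg(S)$ denotes the number of edges of $\mathcal{H}$ containing $S$. For real $p>0$, the $(j,p)$-norm of $\mathcal{H}$ is \[ \|\mathcal{H}\|_{j,p} = \left( \sum_{S \in \binom{V}{j}} \deg(S)^p \right)^{1/p}. \] A $t$-clique of $\mathcal{H}$ is a $t$-subset $K\subseteq V$ all of whose $r$-subsets are edges of $\mathcal{H}$; $k_t^{(r)}(\mathcal{H})$ denotes the number of $t$-cliques in $\mathcal{H}$. For real $x\ge 0$ and a nonnegative integer $k$, $\binom{x}{k} = \frac{x(x-1)\cdots(x-k+1)}{k!}$. It is known (Chao, Dong, Shen, Yang) that when $p>\frac{t-j}{r-j}$, the function $\tilde h$ has a unique maximizer $\tilde{s}_{\mathbb{R}}$ on $(t-1,\infty)$, and that $\tilde h$ is strictly increasing on $(t-1,\tilde{s}_{\mathbb{R}}]$ and strictly decreasing on $[\tilde{s}_{\mathbb{R}},\infty)$. *)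

(* Defs.v *)
From HB Require Import structures.
From mathcomp Require Import all_boot all_order all_algebra.
From mathcomp Require Import reals exp.
Set Implicit Arguments.
Unset Strict Implicit.
Unset Printing Implicit Defensive.
Import Order.TTheory GRing.Theory Num.Theory.
Local Open Scope ring_scope.

Definition gbinom (R : realType) (x : R) (k : nat) : R :=
  (\prod_(i < k) (x - i%:R)) / k`!%:R.

Definition uniform_hypergraph (V : finType) (r : nat) (H : {set {set V}}) : Prop :=
  {in H, forall e : {set V}, #|e| = r}.

Definition hdeg (V : finType) (H : {set {set V}}) (S : {set V}) : nat :=
  #|[set e in H | S \subset e]|.

Definition hnorm (R : realType) (V : finType) (H : {set {set V}})
    (j : nat) (p : R) : R :=
  (\sum_(S : {set V} | #|S| == j) (hdeg H S)%:R `^ p) `^ p^-1.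

Definition is_clique (V : finType) (r t : nat) (H : {set {set V}})
    (K : {set V}) : bool :=
  (#|K| == t) && [forall (e : {set V} | (e \subset K) && (#|e| == r)), e \in H].

Definition clique_count (V : finType) (r t : nat) (H : {set {set V}}) : nat :=
  #|[set K : {set V} | is_clique r t H K]|.

(* For x > t - 1 with t > r > j, all three binomials are positive, so that
   powR, which is junk on a negative base, is the usual real power. *)
Definition htilde (R : realType) (t r j : nat) (p x : R) : R :=
  gbinom x t / (gbinom x j * gbinom (x - j%:R) (r - j) `^ p).

Definition maximizes_on (R : realType) (I : interval R) (f : R -> R) (s : R) : Prop :=
  s \in I /\ {in I, forall x, f x <= f s}.

(* Main.v *)
(* Put a = r - j, b = t - j.  By double counting, 'C(t, j) times the number of
   t-cliques is the sum over the j-sets S of the number of b-cliques in the link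
   of S, an a-graph with deg S edges.  By Lovasz's form of the Kruskal-Katona
   theorem this number is at most gbinom y b when deg S = gbinom y a and
   y >= b - 1, and it vanishes for smaller degrees.
   The quotient of the logarithmic derivatives of gbinom y b and gbinom y a is
   decreasing in y, so ln (gbinom y b) is concave in ln (gbinom y a); writing
   q for this quotient at u - j, this gives
   gbinom y b / gbinom (u - j) b <= w^q with w = gbinom y a / gbinom (u - j) a.
   Maximality of s says that q <= p as soon as u >= s, whence
   w^q <= 1 - q/p + (q/p) w^p, a bound which is affine in (deg S)^p and can be
   summed against the norm constraint. *)
Require Import Defs.
From mathcomp Require Import all_boot all_order all_algebra.
From mathcomp Require Import reals exp.
From mathcomp Require Import ring lra.
Set Implicit Arguments.
Unset Strict Implicit.
Unset Printing Implicit Defensive.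
Import Order.TTheory GRing.Theory Num.Theory.
Local Open Scope ring_scope.

(** * Cliques, links and double counting *)

Section Cliques.
Variable V : finType.
Implicit Types (F G H : {set {set V}}) (S K e : {set V}) (r t j k : nat).

Definition cliques r t H := [set K : {set V} | is_clique r t H K].

Definition link H S := [set e :\: S | e in [set e in H | S \subset e]].

Lemma cliquesP r t H K :
  reflect (#|K| = t /\ forall e, e \subset K -> #|e| = r -> e \in H)
          (K \in cliques r t H).
Proof.
rewrite inE; apply: (iffP andP) => -[/eqP Kt HK]; split => //; last first.
- by apply/forallP => e; apply/implyP => /andP[eK /eqP]; exact: HK.
- by move=> e eK er; move/forallP/(_ e)/implyP: HK; apply; rewrite eK er /=.
Qed.

Lemma cliques_uniform r t H : uniform_hypergraph t (cliques r t H).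
Proof. by move=> K /cliquesP[]. Qed.

Lemma hdegE H S : hdeg H S = (\sum_(e in H) (S \subset e))%N.
Proof.
rewrite /hdeg -sum1_card big_mkcond [RHS]big_mkcond /=.
by apply: eq_bigr => e _; rewrite inE; case: (e \in H); case: (S \subset e).
Qed.

Lemma sum_hdeg r j H : uniform_hypergraph r H ->
  (\sum_(S : {set V} | #|S| == j) hdeg H S = 'C(r, j) * #|H|)%N.
Proof.
move=> Hr; under eq_bigr do rewrite hdegE.
rewrite exchange_big /= mulnC -sum_nat_const; apply: eq_bigr => e eH.
rewrite -(Hr e eH) -cards_draws -sum1_card big_mkcond [RHS]big_mkcond /=.
by apply: eq_bigr => S _; rewrite inE andbC; case: eqP; case: (S \subset e).
Qed.

Lemma setD_inj_on S : {in [pred e : {set V} | S \subset e] &,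
  injective (fun e => e :\: S)}.
Proof.
move=> e f /= Se Sf ef.
by rewrite -(setID e S) -(setID f S) ef (setIidPr Se) (setIidPr Sf).
Qed.

Lemma card_link H S : #|link H S| = hdeg H S.
Proof.
rewrite card_in_imset // => e f; rewrite !inE => /andP[_ Se] /andP[_ Sf].
exact: (@setD_inj_on S e f).
Qed.

Lemma link_uniform r H S : uniform_hypergraph r H ->
  uniform_hypergraph (r - #|S|) (link H S).
Proof.
move=> Hr _ /imsetP[e /setIdP[/Hr <- Se] ->].
by rewrite cardsD (setIidPr Se).
Qed.

(** If [K] is a clique containing [S], then [K :\: S] is a clique of the link: adding [S] to a
    subset of [K :\: S] of the right size gives an [r]-subset of [K]. *)
Lemma hdeg_cliques_le r t H S : (#|S| <= r)%N ->
  (hdeg (cliques r t H) S <= clique_count (r - #|S|) (t - #|S|) (link H S))%N.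
Proof.
move=> Sr; rewrite -card_link; apply/subset_leq_card/subsetP => L.
move=> /imsetP[K /setIdP[/cliquesP[Kt HK] SK] ->]; apply/cliquesP.
rewrite cardsD (setIidPr SK) Kt; split => // e eKS er.
have eS : [disjoint e & S] by move: eKS; rewrite subsetD => /andP[].
apply/imsetP; exists (e :|: S).
  rewrite inE subsetUr andbT HK // ?subUset ?SK ?andbT.
    by apply: subset_trans eKS _; exact: subsetDl.
  by rewrite cardsU (disjoint_setI0 eS) cards0 subn0 er subnK.
by rewrite setDUl setDv setU0; apply/esym/setDidPl.
Qed.

(** For [S = [set x]], [K |-> K :\: S] injects the cliques through [x] into the edges avoiding [x];
    the remaining edges are counted by [hdeg H S]. *)
Lemma hdeg_cliques_shadow r H S : #|S| = 1%N ->
  (hdeg (cliques r r.+1 H) S + hdeg H S <= #|H|)%N.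
Proof.
move=> S1; have /cards1P[x SE] : #|S| == 1%N by exact/eqP.
rewrite /hdeg -(cardsID [set e : {set V} | S \subset e] H) addnC leq_add //.
  by apply/subset_leq_card/subsetP => e; rewrite !inE.
rewrite -[leqLHS](card_link (cliques r r.+1 H) S).
apply/subset_leq_card/subsetP => L.
move=> /imsetP[K /setIdP[/cliquesP[Kr HK] SK] ->]; rewrite !inE HK ?subsetDl //.
  by rewrite andbT SE sub1set !inE eqxx.
by rewrite cardsD (setIidPr SK) Kr S1 subn1.
Qed.

Lemma cliques_id r H : uniform_hypergraph r H -> cliques r r H = H.
Proof.
move=> Hr; apply/setP => K; apply/cliquesP/idP => [[Kr ->]//|KH].
split=> [|e eK er]; first exact: Hr.
suff -> : e = K by [].
by apply/eqP; rewrite eqEcard eK er (Hr K KH) leqnn.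
Qed.

(** Allows passing from size [k] to [k.+1] by treating the [k]-cliques as a [k]-graph. *)
Lemma cliques_cliques r k H : (r <= k)%N ->
  cliques r k.+1 H \subset cliques k k.+1 (cliques r k H).
Proof.
move=> rk; apply/subsetP => K /cliquesP[Kk HK]; apply/cliquesP;
  split => // e eK ek.
apply/cliquesP; split => // f fe fr; apply: HK => //.
exact: subset_trans eK.
Qed.

End Cliques.

(** * Binomial coefficients with a real upper argument *)

Section GeneralizedBinomial.
Variable R : realType.
Implicit Types (x y : R) (j k : nat).

Lemma fact_neq0 k : k`!%:R != 0 :> R.
Proof. by rewrite pnatr_eq0 -lt0n fact_gt0. Qed.

Lemma gbinom0 x : gbinom x 0 = 1.
Proof. by rewrite /gbinom big_ord0 divr1. Qed.

Lemma gbinomS x k : gbinom x k.+1 = gbinom x k * (x - k%:R) / k.+1%:R.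
Proof.
by rewrite /gbinom big_ord_recr /= factS natrM; field;
  rewrite nat1r pnatr_eq0 fact_neq0.
Qed.

Lemma gbinomSl x k : gbinom x k.+1 = x / k.+1%:R * gbinom (x - 1) k.
Proof.
rewrite /gbinom big_ord_recl /= subr0 factS natrM.
have -> : \prod_(i < k) (x - (bump 0 i)%:R) = \prod_(i < k) (x - 1 - i%:R).
  by apply: eq_bigr => i _; rewrite /bump /= natrD; ring.
by field; rewrite fact_neq0 nat1r pnatr_eq0.
Qed.

Lemma gbinomD x j k :
  gbinom x (j + k) * 'C(j + k, j)%:R = gbinom x j * gbinom (x - j%:R) k.
Proof.
have H := bin_fact (leq_addr k j); rewrite addKn in H.
have -> : 'C(j + k, j)%:R = (j + k)`!%:R / (j`!%:R * k`!%:R) :> R.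
  by rewrite -H !natrM mulfK // mulf_neq0 ?fact_neq0.
rewrite /gbinom big_split_ord /=.
under [X in _ * X / _]eq_bigr do rewrite natrD opprD addrA.
by field; rewrite ?fact_neq0.
Qed.

Lemma gbinom_ge0 x k : k%:R - 1 <= x -> 0 <= gbinom x k.
Proof.
move=> xk; apply: divr_ge0; last exact: ler0n.
apply: prodr_ge0 => i _; have := ltn_ord i; rewrite -(ler_nat R) -natr1; lra.
Qed.

Lemma gbinom_gt0 x k : k%:R - 1 < x -> 0 < gbinom x k.
Proof.
move=> xk; apply: divr_gt0; last by rewrite ltr0n fact_gt0.
apply: prodr_gt0 => i _; have := ltn_ord i; rewrite -(ler_nat R) -natr1; lra.
Qed.

Lemma gbinom_lt x y k : (0 < k)%N -> k%:R - 1 <= x -> x < y ->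
  gbinom x k < gbinom y k.
Proof.
case: k => // k _; elim: k => [|k IH] xk xy.
  by rewrite !gbinomS !gbinom0 !mul1r !subr0 !divr1.
rewrite gbinomS [ltRHS]gbinomS ltr_pM2r ?invr_gt0 ?ltr0n //.
move: xk; rewrite -natr1 => xk.
apply: ltr_pM; first by apply: gbinom_ge0; lra.
- lra.
- by apply: IH => //; lra.
- lra.
Qed.

Lemma gbinom_surj x k (M : R) : (0 < k)%N -> k%:R - 1 <= x -> gbinom x k <= M ->
  exists2 y, x <= y & gbinom y k = M.
Proof.
case: k => // k _; rewrite -natr1 addrK => xk xM.
pose P : {poly R} := \prod_(i < k.+1) ('X - i%:R%:P) - (k.+1`!%:R * M)%:P.
have PE y : P.[y] = k.+1`!%:R * (gbinom y k.+1 - M).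
  rewrite /P /gbinom hornerD hornerN hornerC horner_prod.
  under eq_bigr do rewrite hornerXsubC.
  by rewrite mulrBr [_ * (_ / _)]mulrC divfK ?fact_neq0.
have M_ge0 : 0 <= M.
  by apply: le_trans xM; apply: gbinom_ge0; rewrite -natr1 addrK.
have f_ge1 : 1 <= k.+1`!%:R :> R by rewrite ler1n fact_gt0.
pose z : R := x + 1 + k.+1`!%:R * M.
have z_ge : x <= z.
  by rewrite /z -addrA lerDl addr_ge0 // mulr_ge0 // ltW // (lt_le_trans ltr01).
have [|v /andP[xv vz] /rootP] := @poly_ivt R P x z z_ge.
  rewrite !PE; apply/andP; split.
    by rewrite pmulr_rle0 ?subr_le0 // (lt_le_trans ltr01).
  rewrite pmulr_rge0 ?subr_ge0 ?(lt_le_trans ltr01) //.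
  rewrite /gbinom ler_pdivlMr ?(lt_le_trans ltr01) // mulrC big_ord_recr /=.
  apply: le_trans (ler_peMl _ _).
  - by rewrite /z; lra.
  - by move: (mulr_ge0 (ler0n R k.+1`!) M_ge0); rewrite /z; lra.
  - apply: (big_ind (fun y => 1 <= y)) => // [y1 y2|i _];
    first exact: mulr_ege1.
    move: (mulr_ge0 (ler0n R k.+1`!) M_ge0) (ltnW (ltn_ord i)).
    by rewrite -(ler_nat R) /z; lra.
rewrite PE => /eqP; rewrite mulf_eq0 (negPf (fact_neq0 _)) /= subr_eq0 => /eqP.
by exists v.
Qed.

End GeneralizedBinomial.

(** * Lovasz's form of the Kruskal-Katona theorem *)

Section KruskalKatona.
Variables (R : realType) (V : finType).
Implicit Types (G H : {set {set V}}) (x y : R) (k r t : nat).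

(* Keevash's proof of Lovasz's theorem: for a vertex v, either its link is small
   and induction applies, or deg v is large and one uses that removing v maps
   the cliques through v to distinct edges avoiding v. *)
Lemma clique_ratio_step r G x :
  (forall (F : {set {set V}}) (y : R), uniform_hypergraph r F -> r%:R <= y ->
    #|F|%:R < gbinom y r ->
    r.+1%:R * (clique_count r r.+1 F)%:R <= (y - r%:R) * #|F|%:R) ->
  uniform_hypergraph r.+1 G -> r.+1%:R <= x -> #|G|%:R <= gbinom x r.+1 ->
  r.+2%:R * (clique_count r.+1 r.+2 G)%:R <= (x - r.+1%:R) * #|G|%:R.
Proof.
move=> IH Gr rx Gx; pose T := cliques r.+1 r.+2 G.
have local (S : {set V}) : #|S| == 1%N ->
    r.+1%:R * (hdeg T S)%:R <= (x - r.+1%:R) * (hdeg G S)%:R.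
  move=> /eqP S1; have [dS|dS] := ltP (hdeg G S)%:R (gbinom (x - 1) r).
    have Lr := link_uniform (S := S) Gr; rewrite S1 subn1 /= in Lr.
    have rx1 : r%:R <= x - 1 by rewrite lerBrDr natr1.
    have := IH _ _ Lr rx1; rewrite card_link => /(_ dS).
    have -> : x - 1 - r%:R = x - r.+1%:R by rewrite -natr1; ring.
    apply: le_trans.
    rewrite ler_pM2l ?ltr0n // ler_nat.
    by have := @hdeg_cliques_le _ r.+1 r.+2 G S; rewrite S1 !subn1 /=; apply.
  have := hdeg_cliques_shadow r.+1 G S1;
    rewrite -(ler_nat R) natrD -/T => shadow.
  (* For large degree, this and the shadow bound give (r + 1) deg_T S <= (r + 1) (|G| - deg S) <= (x
     - r - 1) deg S. *)
  have : r.+1%:R * #|G|%:R <= x * (hdeg G S)%:R.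
    apply: (@le_trans _ _ (x * gbinom (x - 1) r)).
      apply: le_trans (ler_wpM2l (ler0n R r.+1) Gx) _.
      by rewrite gbinomSl mulrA [_ * (x / _)]mulrC divfK // pnatr_eq0.
    by rewrite ler_wpM2l // (le_trans _ rx).
  have : r.+1%:R * (hdeg T S)%:R <= r.+1%:R * (#|G|%:R - (hdeg G S)%:R) :> R.
    by rewrite ler_wpM2l //; lra.
  lra.
have : \sum_(S : {set V} | #|S| == 1%N) r.+1%:R * (hdeg T S)%:R <=
       \sum_(S : {set V} | #|S| == 1%N) (x - r.+1%:R) * (hdeg G S)%:R.
  exact: ler_sum.
rewrite -!mulr_sumr -!natr_sum (sum_hdeg 1 Gr).
rewrite (sum_hdeg 1 (@cliques_uniform _ _ _ _)).
rewrite !bin1 !natrM [leRHS]mulrCA.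
by rewrite ler_pM2l ?ltr0n.
Qed.

(* The strict hypothesis makes [r = 0] a valid (vacuous) base case. *)
Lemma clique_ratio_lt r G x : uniform_hypergraph r G -> r%:R <= x ->
  #|G|%:R < gbinom x r ->
  r.+1%:R * (clique_count r r.+1 G)%:R <= (x - r%:R) * #|G|%:R.
Proof.
elim: r G x => [|r IH] G x Gr rx Gx; last first.
  by apply: clique_ratio_step => //; exact: ltW.
move: Gx; rewrite gbinom0 ltrn1 ltnS leqn0 cards_eq0 => /eqP G0.
suff -> : clique_count 0 1 G = 0%N by rewrite G0 cards0 !mulr0.
apply/eqP; rewrite cards_eq0; apply/eqP/setP => K; rewrite [RHS]inE.
apply/negP => /cliquesP[_ /(_ set0 (sub0set _) (cards0 _))].
by rewrite G0 inE.
Qed.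

(** The step needs the strict bound only one uniformity lower, so equality is allowed here. *)
Lemma clique_ratio r G x : (0 < r)%N -> uniform_hypergraph r G -> r%:R <= x ->
  #|G|%:R <= gbinom x r ->
  r.+1%:R * (clique_count r r.+1 G)%:R <= (x - r%:R) * #|G|%:R.
Proof.
by case: r => // r _; apply: clique_ratio_step => F y; exact: clique_ratio_lt.
Qed.

(** Induction on [t] with [x] fixed: the ratio bound for the [t]-graph of [t]-cliques contributes
    the factor (x - t) / (t + 1), exactly as in [gbinomS]. *)
Lemma kruskal_katona_lovasz r t G x : (0 < r)%N -> (r <= t)%N ->
  uniform_hypergraph r G -> t%:R - 1 <= x -> #|G|%:R <= gbinom x r ->
  (clique_count r t G)%:R <= gbinom x t.
Proof.
move=> r_gt0 + Gr + Gx; elim: t => [|t IH].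
  by rewrite leqn0 => /eqP r0; rewrite r0 in r_gt0.
rewrite leq_eqVlt => /predU1P[<- _|];
  first by rewrite /clique_count -/(cliques r r G) cliques_id.
rewrite ltnS => rt; rewrite -natr1 addrK => tx.
have Gt : (clique_count r t G)%:R <= gbinom x t by apply: IH => //; lra.
have := clique_ratio (leq_trans r_gt0 rt) (@cliques_uniform _ r t G) tx Gt.
rewrite mulrC -ler_pdivlMr ?ltr0n // => H.
apply: le_trans (le_trans H _);
  first by rewrite ler_nat subset_leq_card // cliques_cliques.
by rewrite gbinomS ler_pM2r ?invr_gt0 ?ltr0n // mulrC ler_wpM2r // subr_ge0.
Qed.

End KruskalKatona.

(** * Logarithmic concavity and tangent bounds *)

Section LogConcavity.
Variable R : realType.
Implicit Types (u x y p q w : R) (a b i j k : nat).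

Lemma weighted_mean_gt0 (l w : R) : 0 <= l <= 1 -> 0 < w -> 0 < 1 - l + l * w.
Proof.
move=> /andP[l0]; rewrite le_eqVlt => /predU1P[->|l1] w0.
  by rewrite subrr add0r mul1r.
by rewrite ltr_pwDl ?subr_gt0 // mulr_ge0 // ltW.
Qed.

(** Apply ln z <= z - 1 at w / M and 1 / M, where M is the mean; with weights l and 1 - l the
    right-hand sides add up to 0. *)
Lemma ln_weighted_amgm (l w : R) : 0 <= l <= 1 -> 0 < w ->
  l * ln w <= ln (1 - l + l * w).
Proof.
move=> /andP[l0 l1] w0; set M := 1 - l + l * w.
have M0 : 0 < M by apply: weighted_mean_gt0 => //; rewrite l0.
have ln_le (z : R) : 0 < z -> ln z <= z - 1.
  by move=> z0; have := @le_ln1Dx R (z - 1); rewrite [1 + _]addrC subrK;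
    apply; lra.
have H1 := ler_wpM2l l0 (ln_le _ (divr_gt0 w0 M0)).
have l1' : 0 <= 1 - l by lra.
have H2 : (1 - l) * ln M^-1 <= (1 - l) * (M^-1 - 1).
  by apply: ler_wpM2l => //; apply: ln_le; rewrite invr_gt0.
rewrite ln_div ?posrE // in H1; rewrite lnV ?posrE // in H2.
have H3 : l * (w / M - 1) + (1 - l) * (M^-1 - 1) = 0.
  by rewrite /M; field; exact: lt0r_neq0.
lra.
Qed.

(* [ln (1 + h c) / c] is nonincreasing in [c], by concavity of [ln]. *)
Lemma ln_chord (h c d : R) : 0 < c -> c <= d -> 0 < 1 + h * d ->
  c * ln (1 + h * d) <= d * ln (1 + h * c).
Proof.
move=> c0 cd hd; have d0 := lt_le_trans c0 cd.
have cd01 : 0 <= c / d <= 1.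
  by rewrite divr_ge0 ?(ltW c0) ?(ltW d0) //= ler_pdivrMr // mul1r.
have := ln_weighted_amgm cd01 hd.
have -> : 1 - c / d + c / d * (1 + h * d) = 1 + h * c.
  by field; exact: lt0r_neq0.
by rewrite mulrAC ler_pdivrMr // [ln _ * d]mulrC.
Qed.

(* The logarithmic derivative of [gbinom u k] in [u]. *)
Definition dlog_gbinom u k := \sum_(i < k) (u - i%:R)^-1.

Lemma dlog_gbinom_gt0 u k : (0 < k)%N -> k%:R - 1 < u -> 0 < dlog_gbinom u k.
Proof.
case: k => // k _; rewrite -natr1 addrK => ku.
rewrite /dlog_gbinom big_ord_recr /= ltr_wpDl ?invr_gt0 ?subr_gt0 //.
apply: sumr_ge0 => i _; rewrite invr_ge0 subr_ge0.
by have := ltnW (ltn_ord i); rewrite -(ler_nat R); lra.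
Qed.

Lemma ln_gbinom_ratioS u y k : k%:R < u -> k%:R < y ->
  ln (gbinom y k.+1 / gbinom u k.+1) =
  ln (gbinom y k / gbinom u k) + ln ((y - k%:R) / (u - k%:R)).
Proof.
move=> ku ky.
have [gu gy] : 0 < gbinom u k /\ 0 < gbinom y k by split; apply: gbinom_gt0;
  lra.
have [uk yk] : 0 < u - k%:R /\ 0 < y - k%:R by split; lra.
rewrite -lnM ?posrE ?(divr_gt0 gy gu) ?(divr_gt0 yk uk) // !gbinomS; congr ln.
by field; rewrite !lt0r_neq0 // nat1r ltr0n.
Qed.

Lemma ln_gbinom_ratio u y k : k%:R - 1 < u -> k%:R - 1 < y ->
  ln (gbinom y k / gbinom u k) = \sum_(i < k) ln ((y - i%:R) / (u - i%:R)).
Proof.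
elim: k => [|k IH]; first by rewrite big_ord0 !gbinom0 divr1 ln1.
rewrite -natr1 addrK => ku ky;
  rewrite ln_gbinom_ratioS // big_ord_recr /= IH //; lra.
Qed.

(* The tangent at [y = u] to the concave curve
   ([ln (gbinom y a)], [ln (gbinom y b)]). *)
Lemma ln_gbinom_tangent u y a b : (a <= b)%N -> b%:R - 1 < u -> b%:R - 1 < y ->
  dlog_gbinom u a * ln (gbinom y b / gbinom u b) <=
  dlog_gbinom u b * ln (gbinom y a / gbinom u a).
Proof.
elim: b => [|b IH]; first by rewrite leqn0 => /eqP->.
rewrite leq_eqVlt => /predU1P[->//|]; rewrite ltnS => ab.
rewrite -natr1 addrK => bu byy.
rewrite ln_gbinom_ratioS // /dlog_gbinom big_ord_recr /= -/(dlog_gbinom u a)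
  -/(dlog_gbinom u b).
rewrite [leLHS]mulrDr [leRHS]mulrDl lerD //; first by apply: IH => //; lra.
have abR : a%:R <= b%:R :> R by rewrite ler_nat.
rewrite ln_gbinom_ratio; [|lra|lra].
rewrite mulr_suml mulr_sumr; apply: ler_sum => i _.
have ib : i%:R <= b%:R :> R by rewrite ler_nat (leq_trans (ltnW (ltn_ord i))).
(* The new factor, of index [b], is compared with each factor of index i < a by [ln_chord], with h =
   y - u, c = 1 / (u - i) and d = 1 / (u - b). *)
have E k : (k <= b)%N -> (y - k%:R) / (u - k%:R) = 1 + (y - u) * (u - k%:R)^-1.
  rewrite -(ler_nat R) => kb; have uk : u - k%:R != 0 by rewrite lt0r_neq0 //;
    lra.
  by field.
rewrite !E // ?(leq_trans (ltnW (ltn_ord i))) //.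
apply: ln_chord; first by rewrite invr_gt0; lra.
- by rewrite lef_pV2 ?posrE; lra.
- by rewrite -E // divr_gt0 //; lra.
Qed.

(** The tangent bounds the ratio by w^(l p), and weighted AM-GM makes this affine in w^p; the slope
    hypothesis is l <= 1. *)
Lemma gbinom_tangent u y a b p (l := dlog_gbinom u b / (p * dlog_gbinom u a)) :
  (0 < a <= b)%N -> b%:R - 1 < u -> b%:R - 1 < y ->
  0 < p -> dlog_gbinom u b <= p * dlog_gbinom u a ->
  gbinom y b <= gbinom u b * (1 - l + l * (gbinom y a / gbinom u a) `^ p).
Proof.
move=> /andP[a0 ab] bu byy p0 slope.
have abR : a%:R <= b%:R :> R by rewrite ler_nat.
have da : 0 < dlog_gbinom u a by apply: dlog_gbinom_gt0 => //; lra.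
have db : 0 < dlog_gbinom u b by apply: dlog_gbinom_gt0 => //;
  exact: leq_trans ab.
have gub : 0 < gbinom u b by exact: gbinom_gt0.
have gyb : 0 < gbinom y b by exact: gbinom_gt0.
have gua : 0 < gbinom u a by apply: gbinom_gt0; lra.
have gya : 0 < gbinom y a by apply: gbinom_gt0; lra.
have l01 : 0 <= l <= 1.
  by rewrite divr_ge0 ?mulr_ge0 ?(ltW da) ?(ltW db) ?(ltW p0) //= ler_pdivrMr
    ?mulr_gt0 // mul1r.
have w0 : 0 < (gbinom y a / gbinom u a) `^ p by exact/powR_gt0/divr_gt0.
have := ln_gbinom_tangent ab bu byy; rewrite mulrC -ler_pdivlMr // => H.
have := ln_weighted_amgm l01 w0; rewrite ln_powR => H2.
rewrite mulrC -ler_pdivrMr //.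
rewrite -ler_ln ?posrE ?(divr_gt0 gyb gub) //; last first.
  exact: weighted_mean_gt0.
apply: (le_trans H); apply: le_trans H2; rewrite le_eqVlt; apply/predU1P; left.
by rewrite /l; field; rewrite !lt0r_neq0.
Qed.

End LogConcavity.

(** * The slope condition at and beyond the maximizer *)

Section Maximizer.
Variable R : realType.
Implicit Types (x y s p : R) (j k t r : nat).

Lemma powR_div x y p : 0 <= x -> 0 <= y -> (x / y) `^ p = x `^ p / y `^ p.
Proof.
by move=> x0 y0; rewrite powRM ?invr_ge0 // -powR_inv1 // powRAC powR_inv1
  ?powR_ge0.
Qed.

Lemma htildeE t r j p x : (j <= t)%N -> t%:R - 1 < x ->
  htilde t r j p x =
  gbinom (x - j%:R) (t - j) / gbinom (x - j%:R) (r - j) `^ p / 'C(t, j)%:R.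
Proof.
move=> jt tx; have jtR : j%:R <= t%:R :> R by rewrite ler_nat.
have gx : gbinom x j != 0 by apply/lt0r_neq0/gbinom_gt0; lra.
have Ctj : 'C(t, j)%:R != 0 :> R by rewrite pnatr_eq0 -lt0n bin_gt0.
have := gbinomD x j (t - j); rewrite subnKC // => H.
rewrite /htilde invfM -[gbinom x t](mulfK Ctj) H; set P := (_ `^ p)^-1.
by field; rewrite gx Ctj.
Qed.

(* One-sided continuity of [dlog_gbinom ^~ k] at [s], in the quantitative form
   [d * dlog_gbinom s k <= (d + e) * dlog_gbinom (s + e) k], d = s - k + 1. *)
Lemma dlog_gbinom_near s k (A : R) : k%:R - 1 < s ->
  (forall y, s < y -> dlog_gbinom y k <= A) -> dlog_gbinom s k <= A.
Proof.
move=> ks near; have A0 : 0 <= A.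
  apply: le_trans (near (s + 1) _); last by rewrite ltrDl.
  apply: sumr_ge0 => i _; have := ltn_ord i; rewrite -(ler_nat R) -natr1 => ik.
  rewrite invr_ge0; lra.
set D := dlog_gbinom s k; pose d := s - (k%:R - 1).
have d0 : 0 < d by rewrite subr_gt0.
(* Termwise d / (s - i) <= (d + e) / (s + e - i), because s - i >= d. *)
have scale e : 0 < e -> d * D <= (d + e) * A.
  move=> e0; have se : s < s + e by rewrite ltrDl.
  apply: le_trans (ler_wpM2l _ (near _ se)); last by rewrite addr_ge0 ?ltW.
  rewrite !mulr_sumr; apply: ler_sum => i _.
  have := ltn_ord i; rewrite -(ler_nat R) -natr1 => ik.
  have si : 0 < s - i%:R by lra.
  have sei : 0 < s + e - i%:R by lra.
  rewrite ler_pdivrMr // mulrAC ler_pdivlMr //.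
  have : 0 <= e * (s - i%:R - d) by rewrite mulr_ge0 ?(ltW e0) // /d; lra.
  lra.
rewrite leNgt; apply/negP => AD.
have A1 : 0 < A + 1 by lra.
(* This [e] satisfies e A < d (D - A), contradicting [scale]. *)
have e0 : 0 < d * (D - A) / (A + 1) by rewrite divr_gt0 // mulr_gt0 // subr_gt0.
have := scale _ e0.
have : d * (D - A) / (A + 1) * A < d * (D - A).
  by rewrite mulrAC ltr_pdivrMr // ltr_pM2l ?mulr_gt0 ?subr_gt0 // ltrDl.
lra.
Qed.

Lemma dlog_gbinom_le s y k : k%:R - 1 < s -> s <= y ->
  dlog_gbinom y k <= dlog_gbinom s k.
Proof.
move=> ks sy; apply: ler_sum => i _; have := ltn_ord i;
  rewrite -(ler_nat R) -natr1 => ik.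
rewrite lef_pV2 ?posrE; lra.
Qed.

(** The logarithmic derivative of [htilde] at [y] is nonpositive; this is derived from maximality
    and the tangent inequality without differentiating. *)
Lemma maximizer_slope t r j p s y : (j < r <= t)%N -> 0 < p ->
  maximizes_on `]t%:R - 1, +oo[ (htilde t r j p) s -> s <= y ->
  dlog_gbinom (y - j%:R) (t - j) <= p * dlog_gbinom (y - j%:R) (r - j).
Proof.
move=> /andP[jr rt] p0 [+ smax]; rewrite in_itv /= andbT => ts.
have jt : (j < t)%N := leq_trans jr rt.
have bE : (t - j)%:R = t%:R - j%:R :> R by rewrite natrB // ltnW.
have abR : (r - j)%:R <= (t - j)%:R :> R by rewrite ler_nat leq_sub2r.
have strict z : s < z ->
    dlog_gbinom (z - j%:R) (t - j) <= p * dlog_gbinom (z - j%:R) (r - j).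
  move=> sz; pose s' := s - j%:R; pose z' := z - j%:R.
  have tz : t%:R - 1 < z by lra.
  have gts : 0 < gbinom s' (t - j) by apply: gbinom_gt0; rewrite /s'; lra.
  have gtz : 0 < gbinom z' (t - j) by apply: gbinom_gt0; rewrite /z'; lra.
  have grs : 0 < gbinom s' (r - j) by apply: gbinom_gt0; rewrite /s'; lra.
  have grz : 0 < gbinom z' (r - j) by apply: gbinom_gt0; rewrite /z'; lra.
  pose L := ln (gbinom s' (r - j) / gbinom z' (r - j)).
  have L0 : L < 0.
    rewrite /L -ln1 ltr_ln ?posrE ?(divr_gt0 grs grz) // ltr_pdivrMr // mul1r.
    by apply: gbinom_lt; rewrite ?subn_gt0 // /s' /z'; lra.
  (* Compare [z] with [s] through the tangent at [z]: a slope above [p] at [z]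
     would give [htilde s < htilde z]. *)
  have zs : p * L <= ln (gbinom s' (t - j) / gbinom z' (t - j)).
    have := smax z; rewrite in_itv /= andbT => /(_ tz).
    rewrite !htildeE ?(ltnW jt) // ler_pM2r ?invr_gt0 ?ltr0n ?bin_gt0 1?ltnW //.
    rewrite ler_pdivrMr ?powR_gt0 // mulrAC ler_pdivlMr ?powR_gt0 // => H.
    rewrite -ln_powR ler_ln ?posrE ?powR_gt0 ?(divr_gt0 grs grz) ?(divr_gt0 gts
      gtz) //.
    rewrite powR_div ?(ltW grs) ?(ltW grz) // ler_pdivrMr ?powR_gt0 // mulrAC.
    by rewrite ler_pdivlMr // mulrC.
  have db : 0 < dlog_gbinom z' (r - j).
    by apply: dlog_gbinom_gt0; rewrite ?subn_gt0 // /z'; lra.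
  have := @ln_gbinom_tangent R z' s' _ _ (leq_sub2r j rt).
  have -> : (t - j)%:R - 1 < z' by rewrite /z'; lra.
  have -> : (t - j)%:R - 1 < s' by rewrite /s'; lra.
  move=> /(_ isT isT); rewrite -/L => H.
  have := le_trans (ler_wpM2l (ltW db) zs) H.
  by rewrite mulrA ler_nM2r // mulrC.
(* At [y = s] the comparison would degenerate to 0 <= 0, so a limit from the right is taken. *)
rewrite le_eqVlt => /predU1P[<-|]; last exact: strict.
apply: dlog_gbinom_near => [|z sz]; first lra.
have := strict (z + j%:R); rewrite addrK => /(_ _)/le_trans; apply; first lra.
rewrite ler_pM2l //; apply: dlog_gbinom_le; lra.
Qed.

End Maximizer.

(** * The bound for one link and its summation over the [j]-sets *)

Lemma clique_count_tangent (R : realType) (V : finType) (a b : nat) (p u : R)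
    (l := dlog_gbinom u b / (p * dlog_gbinom u a)) (G : {set {set V}}) :
  (0 < a <= b)%N -> b%:R - 1 < u -> 0 < p ->
  dlog_gbinom u b <= p * dlog_gbinom u a -> uniform_hypergraph a G ->
  (clique_count a b G)%:R <=
  gbinom u b * (1 - l + l * (#|G|%:R / gbinom u a) `^ p).
Proof.
move=> /andP[a0 ab] bu p0 slope Ga.
have abR : a%:R <= b%:R :> R by rewrite ler_nat.
have da : 0 < dlog_gbinom u a by apply: dlog_gbinom_gt0 => //; lra.
have db : 0 < dlog_gbinom u b by apply: dlog_gbinom_gt0 => //;
  exact: leq_trans ab.
have /andP[l0 l1] : 0 <= l <= 1.
  by rewrite divr_ge0 ?mulr_ge0 ?(ltW da) ?(ltW db) ?(ltW p0) //= ler_pdivrMr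
    ?mulr_gt0 // mul1r.
have few (x : R) : b%:R - 1 <= x -> #|G|%:R <= gbinom x a ->
    (clique_count a b G)%:R <= gbinom x b by exact: kruskal_katona_lovasz.
(* [gbinom (b - 1) b = 0], so at most [gbinom (b - 1) a] edges span no clique. *)
have [Gb|Gb] := leP #|G|%:R (gbinom (b%:R - 1 : R) a).
  apply: le_trans (few _ (lexx _) Gb) _.
  have -> : gbinom (b%:R - 1) b = 0 :> R.
    case: b {few ab bu slope abR db Gb l l0 l1} (leq_trans a0 ab) => // b _.
    by rewrite gbinomS -natr1 addrK subrr mulr0 mul0r.
  apply: mulr_ge0; first exact: gbinom_ge0 (ltW bu).
  by rewrite addr_ge0 ?subr_ge0 // mulr_ge0 ?powR_ge0.
(* [y] is the real parameter at which the edge count is exactly [gbinom y a]; strictness of [Gb]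
   gives y > b - 1, as the tangent bound requires. *)
have [|y byy yG] := gbinom_surj a0 _ (ltW Gb); first lra.
have byy' : b%:R - 1 < y.
  rewrite lt_neqAle byy andbT; apply: contraTneq Gb => ->.
  by rewrite yG ltxx.
rewrite -yG; apply: le_trans (few _ byy _) _; first by rewrite yG.
by apply: gbinom_tangent => //; rewrite a0.
Qed.

Theorem theorem1p3 (R : realType) (t r j n : nat) (C p s : R)
    (V : finType) (H : {set {set V}})
    (j_ge1 : (1 <= j)%N) (j_lt_r : (j < r)%N) (r_lt_t : (r < t)%N)
    (t_le_n : (t <= n)%N)
    (C_gt0 : 0 < C) (p_gt0 : 0 < p)
    (p_gt : (t - j)%:R / (r - j)%:R < p)
    (s_max : maximizes_on `]t%:R - 1, +oo[ (htilde t r j p) s)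
    (C_ge : 'C(n, j)%:R * gbinom (s - j%:R) (r - j) `^ p <= C `^ p)
    (card_V : #|V| = n)
    (H_unif : uniform_hypergraph r H)
    (H_norm : hnorm H j p <= C) :
  exists u : R,
    unique (fun v : R => s <= v /\
      'C(n, j)%:R `^ p^-1 * gbinom (v - j%:R) (r - j) = C) u /\
    (clique_count r t H)%:R <= 'C(n, j)%:R / gbinom u j * gbinom u t.
Proof.
have j_lt_t := ltn_trans j_lt_r r_lt_t.
have ts : t%:R - 1 < s by case: s_max; rewrite in_itv /= andbT.
have bE : (t - j)%:R = t%:R - j%:R :> R by rewrite natrB // ltnW.
have aE : (r - j)%:R = r%:R - j%:R :> R by rewrite natrB // ltnW.
have rtR : r%:R <= t%:R :> R by rewrite ler_nat ltnW.
have jtR : j%:R <= t%:R :> R by rewrite ler_nat ltnW.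
have a0 : (0 < r - j)%N by rewrite subn_gt0.
set a := (r - j)%N in a0 aE p_gt C_ge *.
set b := (t - j)%N in bE p_gt *.
set N : R := 'C(n, j)%:R in C_ge *.
have N0 : 0 < N by rewrite ltr0n bin_gt0 (leq_trans (ltnW j_lt_t)).
have Np0 : 0 < N `^ p^-1 by exact: powR_gt0.
have powNp (x : R) : 0 <= x -> (N `^ p^-1 * x) `^ p = N * x `^ p.
  by move=> x0; rewrite powRM ?powR_ge0 // -powRrM mulVf ?powRr1 ?lt0r_neq0 //
    ltW.
have sa : gbinom (s - j%:R) a <= C / N `^ p^-1.
  rewrite ler_pdivlMr // mulrC leNgt; apply/negP => /(gt0_ltr_powR p_gt0).
  have gs : 0 <= gbinom (s - j%:R) a by apply: gbinom_ge0; lra.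
  rewrite !nnegrE (ltW C_gt0) (mulr_ge0 (ltW Np0) gs) powNp // => /(_ isT isT).
  by rewrite ltNge C_ge.
have [|u' su' u'C] := gbinom_surj a0 _ sa; first lra.
have uC : N `^ p^-1 * gbinom u' a = C by rewrite u'C mulrC divfK ?lt0r_neq0.
exists (u' + j%:R); split.
  split=> [|v [sv]]; first by rewrite addrK uC; split=> //; rewrite -lerBlDr.
  rewrite -[in RHS]uC => /(mulfI (lt0r_neq0 Np0)) gE; apply/eqP.
  have [uv|uv|->] := ltgtP u' (v - j%:R); last by rewrite subrK.
  - have : gbinom u' a < gbinom (v - j%:R) a by apply: gbinom_lt => //; lra.
    by rewrite gE ltxx.
  - have : gbinom (v - j%:R) a < gbinom u' a by apply: gbinom_lt => //; lra.
    by rewrite gE ltxx.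
have gua : 0 < gbinom u' a by apply: gbinom_gt0; lra.
have gub : 0 < gbinom u' b by apply: gbinom_gt0; lra.
have guj : 0 < gbinom (u' + j%:R) j by apply: gbinom_gt0; lra.
have Ctj : 0 < 'C(t, j)%:R :> R by rewrite ltr0n bin_gt0 ltnW.
(* This form matches the double count, which carries the factor ['C(t, j)]. *)
have -> : N / gbinom (u' + j%:R) j * gbinom (u' + j%:R) t =
          N * gbinom u' b / 'C(t, j)%:R.
  have := gbinomD (u' + j%:R) j b; rewrite addrK subnKC 1?ltnW // => E.
  apply: (mulIf (lt0r_neq0 Ctj)); rewrite [RHS]divfK ?lt0r_neq0 //.
  by rewrite -[LHS]mulrA E mulrA divfK ?lt0r_neq0.
rewrite ler_pdivlMr // -natrM mulnC -(sum_hdeg j (@cliques_uniform _ r t H))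
  natr_sum.
have slope : dlog_gbinom u' b <= p * dlog_gbinom u' a.
  have := @maximizer_slope R t r j p s (u' + j%:R).
  by rewrite addrK j_lt_r ltnW // => /(_ isT p_gt0 s_max); apply;
    rewrite -lerBlDr.
pose l := dlog_gbinom u' b / (p * dlog_gbinom u' a).
have l0 : 0 <= l.
  rewrite divr_ge0 ?mulr_ge0 ?(ltW p_gt0) // ltW // dlog_gbinom_gt0 ?subn_gt0
    //; lra.
have local (S : {set V}) : #|S| == j -> (hdeg (cliques r t H) S)%:R <=
    gbinom u' b * (1 - l + l * ((hdeg H S)%:R / gbinom u' a) `^ p).
  move=> /eqP Sj; rewrite -(card_link H S).
  have Lr := link_uniform (S := S) H_unif; rewrite Sj in Lr.
  apply: le_trans (clique_count_tangent _ _ p_gt0 slope Lr).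
  - by rewrite ler_nat /a /b -Sj hdeg_cliques_le // Sj ltnW.
  - by rewrite a0 leq_sub2r // ltnW.
  - lra.
apply: le_trans (ler_sum _ local) _; rewrite -mulr_sumr mulrC.
rewrite ler_pM2r // big_split /= sumr_const -mulr_sumr.
have -> : #|[pred S : {set V} | #|S| == j]| = 'C(n, j).
  by rewrite -card_V -[in RHS]cardsT -cards_draws; apply: eq_card => S;
    rewrite !inE subsetT.
under eq_bigr do rewrite powRM ?invr_ge0 ?(ltW gua) //.
rewrite -mulr_suml.
(* By the choice of [u'], the norm constraint says that the w^p sum to at most [N]; as l >= 0, the
   affine bounds then sum to at most (1 - l) N + l N = N. *)
have sumC : \sum_(S : {set V} | #|S| == j) (hdeg H S)%:R `^ p <=
    N * gbinom u' a `^ p.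
  have := @ge0_ler_powR R p (ltW p_gt0) _ _ _ _ H_norm;
    rewrite !nnegrE powR_ge0 (ltW C_gt0) => /(_ isT isT).
  have sum0 : 0 <= \sum_(S : {set V} | #|S| == j) (hdeg H S)%:R `^ p :> R.
    by apply: sumr_ge0 => S _; exact: powR_ge0.
  by rewrite /hnorm -powRrM mulVf ?lt0r_neq0 // powRr1 // -uC powNp // ltW.
have inv1 : gbinom u' a `^ p * (gbinom u' a)^-1 `^ p = 1.
  by rewrite -powRM ?invr_ge0 ?(ltW gua) // mulfV ?lt0r_neq0 // powR1.
have := ler_wpM2r (powR_ge0 (gbinom u' a)^-1 p) sumC.
rewrite -mulrA inv1 mulr1 => /(ler_wpM2l l0).
rewrite -mulr_natl -/N; lra.
Qed.
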